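(* Let $n\ge 1$, $r\ge 2$ and $0\le a_2,\dots,a_n\le r-1$ be integers, and consider the cyclic quotient singularity $\mathbb{C}^n/G$ of $\frac1r(1,a_2,\dots,a_n)$-type, where $G=\left\langle \frac1r(1,a_2,\dots,a_n)\right\rangle$. The Fujiki-Oka resolution of $\mathbb{C}^n/G$ is crepant if and only if the ages of all the coefficients of the remainder polynomial $\mathcal{R}_*\left(\frac{(1,a_2,\dots,a_n)}{r}\right)$ are equal to $1$.
   Context: Notation. $\frac1r(a_1,\dots,a_n)$ denotes the diagonal matrix $\mathrm{diag}(e^{2\pi\sqrt{-1}a_1/r},\dots,e^{2\pi\sqrt{-1}a_n/r})$ as well as the vector $(a_1/r,\dots,a_n/r)$. Let $\mathbf{e}_1,\dots,\mathbf{e}_n$ be the standard basis of $\mathbb{Z}^n$, $\sigma=\sum_i\mathbb{R}_{\ge0}\mathbf{e}_i$, and $N'=\mathbb{Z}^n+\mathbb{Z}\,\frac1r(1,a_2,\dots,a_n)$. Then $\mathbb{C}^n/G$ is the toric variety $X(N',\sigma)$. For $v=(v_1,\dots,v_n)\in N'_{\mathbb{R}}=\mathbb{R}^n$ put $\mathrm{age}(v)=\sum_i v_i$. Crepancy. Let $\Sigma$ be a fan subdividing $\sigma$ such that $X(N',\Sigma)$ is smooth. The discrepancy of the divisor corresponding to a ray $\tau$ of $\Sigma$ is $\mathrm{age}(A_\tau)-1$, where $A_\tau$ is the primitive generator of $\tau$ in $N'$. The resolution $X(N',\Sigma)\to X(N',\sigma)$ is crepant if all discrepancies vanish, i.e.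 every $A_\tau$ has age $1$. Proper fractions and remainder polynomial. An $n$-dimensional proper fraction is a symbol $\frac{\mathbf{a}}{r}=\frac{(a_1,\dots,a_n)}{r}$ with $r\ge1$ and integers $0\le a_i\le r-1$; its age is $\frac1r\sum_i a_i$. For $2\le i\le n$ the $i$-th remainder map $R_i$ is defined by $$R_i\left(\tfrac{(a_1,a_2,\dots,a_n)}{r}\right)=\frac{(\overline{a_1}^{a_i},\dots,\overline{a_{i-1}}^{a_i},\overline{-r}^{a_i},\overline{a_{i+1}}^{a_i},\dots,\overline{a_n}^{a_i})}{a_i}\ \text{ if } a_i\ne0,$$ and $R_i=\infty$ if $a_i=0$; also $R_i(\infty)=\infty$. Here $\overline{x}^{m}$ is the integer with $0\le\overline{x}^{m}<m$ and $\overline{x}^{m}\equiv x \bmod m$. The remainder polynomial of $\frac{\mathbf{a}}{r}$ with $a_1=1$ is the formal sum in noncommuting variables $x_2,\dots,x_n$ $$\mathcal{R}_*\left(\tfrac{\mathbf{a}}{r}\right)=\tfrac{\mathbf{a}}{r}+\sum_{l\ge1}\ \sum_{(i_1,\dots,i_l)\in\{2,\dots,n\}^l}(R_{i_l}\cdots R_{i_2}R_{i_1})\left(\tfrac{\mathbf{a}}{r}\right)x_{i_1}x_{i_2}\cdots x_{i_l},$$ where terms with coefficient $\infty$ or $\frac{(0,\dots,0)}{1}$ are excluded. (The constant term $\frac{\mathbf{a}}{r}$ counts as a coefficient.) Fujiki-Oka resolution. Let $\tau=\sum_i\mathbb{R}_{\ge0}P_i$ be an $n$-dimensional simplicial cone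 with $P_1,\dots,P_n\in N'$ that is semi-unimodular over $P_1$, meaning that $P_2,\dots,P_n$ is part of a $\mathbb{Z}$-basis of $N'$. Let $s$ be the index of $\bigoplus_i\mathbb{Z}P_i$ in $N'$. If $s>1$, there are unique integers $0\le b_2,\dots,b_n\le s-1$ such that the Oka center $C=\frac1s(P_1+\sum_{i\ge2}b_iP_i)$ lies in $N'$ and $C,P_2,\dots,P_n$ is a $\mathbb{Z}$-basis of $N'$; $\frac{(1,b_2,\dots,b_n)}{s}$ is called the proper fraction of $\tau$ over $P_1$. The star subdivision of $\tau$ at $C$ has as maximal cones the smooth cone on $C,P_2,\dots,P_n$ and, for every $i\ge2$ with $b_i\neq0$, the cone $\tau_i$ obtained from $\tau$ by replacing the generator $P_i$ by $C$. Each $\tau_i$ is semi-unimodular over $P_1$, of index $b_i$, and (if $b_i>1$) its proper fraction over $P_1$ is $R_i\left(\frac{(1,b_2,\dots,b_n)}{s}\right)$. Repeating this for all non-smooth cones $\tau_i$ (always over $P_1$) until all maximal cones are smooth produces a smooth fan. The Fujiki-Oka resolution of $\mathbb{C}^n/G$ is the toric resolution obtained by applying this procedure to $\tau=\sigma$, $P_i=\mathbf{e}_i$ (whose proper fraction over $\mathbf{e}_1$ is $\frac{(1,a_2,\dots,a_n)}{r}$). *)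

(* Defs.v *)
From mathcomp Require Import all_boot all_order all_algebra.
From mathcomp Require Import classical_sets reals.

Set Implicit Arguments.
Unset Strict Implicit.
Unset Printing Implicit Defensive.

Import Order.TTheory GRing.Theory Num.Theory.
Local Open Scope ring_scope.
Local Open Scope classical_set_scope.

Record proper_fraction (n : nat) := ProperFraction {
  pf_num : {ffun 'I_n -> int};
  pf_den : int;
  pfP : (1 <= pf_den) && [forall i, 0 <= pf_num i <= pf_den - 1]
}.

Definition pf_age (n : nat) (f : proper_fraction n) : rat :=
  (\sum_i pf_num f i)%:~R / (pf_den f)%:~R.

Lemma residues_proper (n : nat) (x : 'I_n -> int) (m : int) (m_gt0 : 0 < m) :
  (1 <= m) && [forall i, 0 <= [ffun j => (x j %% m)%Z] i <= m - 1].
Proof.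
apply/andP; split; first by rewrite -gtz0_ge1.
apply/forallP => i; rewrite ffunE modz_ge0 ?gt_eqF //=.
by rewrite -ltzD1 subrK ltz_pmod.
Qed.

Definition residues (n : nat) (x : 'I_n -> int) (m : int) (m_gt0 : 0 < m) :
    proper_fraction n :=
  ProperFraction (residues_proper x m_gt0).

Lemma pf_num_gt0 (n : nat) (f : proper_fraction n) (i : 'I_n) :
  pf_num f i != 0 -> 0 < pf_num f i.
Proof.
move=> fi_neq0; rewrite lt_def fi_neq0 /=.
by have /andP[_ /forallP /(_ i) /andP[]] := pfP f.
Qed.

(* The symbol oo is encoded by [None]. *)
Definition remainder_map (n : nat) (i : 'I_n) (o : option (proper_fraction n)) :
    option (proper_fraction n) :=
  if o is Some f then
    if decP (@idP (pf_num f i != 0)) is left fi_neq0 then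
      Some (residues (fun j => if j == i then - pf_den f else pf_num f j)
                     (pf_num_gt0 fi_neq0))
    else None
  else None.

Definition is_zero_over_one (n : nat) (f : proper_fraction n) : bool :=
  (pf_den f == 1) && [forall i, pf_num f i == 0].

(* A formal sum in noncommuting variables is the map sending a word (a monomial)
   to its coefficient, [None] meaning that the word does not occur.  In dimension
   [n.+1] the variables x_2, ..., x_(n+1) are indexed by ['I_n], the letter
   [i : 'I_n] standing for the coordinate [lift ord0 i]; [foldl] applies the
   remainder map of the first letter of the word first. *)
Definition remainder_polynomial (n : nat) (f : proper_fraction n.+1) :
    seq 'I_n -> option (proper_fraction n.+1) :=
  fun w =>
    let o := foldl (fun o i => remainder_map (lift ord0 i) o) (Some f) w in
    if o is Some c then if is_zero_over_one c then None else Some c else None.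

Definition is_coefficient (n : nat) (p : seq 'I_n -> option (proper_fraction n.+1))
    (c : proper_fraction n.+1) : Prop :=
  exists w, p w = Some c.

Lemma pf1_proper (n : nat) (r : int) (a : 'I_n -> int)
    (r_ge2 : 2 <= r) (a_bound : forall i, 0 <= a i <= r - 1) :
  (1 <= r) && [forall i, 0 <= [ffun j => oapp a 1 (unlift ord0 j)] i <= r - 1].
Proof.
rewrite (le_trans _ r_ge2) //=; apply/forallP => i; rewrite ffunE.
by case: unliftP => [j _|_] //=; rewrite lerBrDr.
Qed.

Definition pf1 (n : nat) (r : int) (a : 'I_n -> int)
    (r_ge2 : 2 <= r) (a_bound : forall i, 0 <= a i <= r - 1) :
    proper_fraction n.+1 :=
  ProperFraction (pf1_proper r_ge2 a_bound).

Section Toric.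
Variable K : realType.

Definition pf_vector (n : nat) (f : proper_fraction n) : 'rV[K]_n :=
  \row_i ((pf_num f i)%:~R / (pf_den f)%:~R).

Definition overlattice (n : nat) (f : proper_fraction n) : set 'rV[K]_n :=
  [set v | exists (z : 'rV[int]_n) (k : int),
             v = map_mx intr z + k%:~R *: pf_vector f].

Definition age (n : nat) (v : 'rV[K]_n) : K := \sum_i v 0 i.

(* A simplicial cone of full dimension is given by the square matrix [P] whose
   rows are its ordered generators P_1, ..., P_n; [row ord0 P] is P_1. *)

Definition int_span (n : nat) (P : 'M[K]_n) : set 'rV[K]_n :=
  [set v | exists z : 'rV[int]_n, v = map_mx intr z *m P].

Definition is_Zbasis (n : nat) (N : set 'rV[K]_n) (P : 'M[K]_n) : Prop :=
  (forall i, N (row i P)) /\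
  (forall v, N v -> exists! z : 'rV[int]_n, v = map_mx intr z *m P).

(* [L] has index [s] in [N]: there are [s] coset representatives. *)
Definition has_index (n : nat) (N L : set 'rV[K]_n) (s : nat) : Prop :=
  exists t : 'I_s -> 'rV[K]_n,
    (forall k, N (t k)) /\ (forall v, N v -> exists! k, L (v - t k)).

Definition replace_row (n : nat) (P : 'M[K]_n) (i : 'I_n) (C : 'rV[K]_n) :
    'M[K]_n :=
  \matrix_(j < n) (if j == i then C else row j P).

(* For [b] = (1, b_2, ..., b_n) / s this is (P_1 + \sum_(i >= 2) b_i P_i) / s. *)
Definition oka_center (n : nat) (P : 'M[K]_n) (b : proper_fraction n) :
    'rV[K]_n :=
  pf_vector b *m P.

(* [b] is the proper fraction over P_1 of the non-smooth cone [P].  The basis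
   condition contains the semi-unimodularity of [P] over P_1. *)
Definition proper_fraction_of_cone (n : nat) (N : set 'rV[K]_n.+1)
    (P : 'M[K]_n.+1) (b : proper_fraction n.+1) : Prop :=
  exists s : nat,
    [/\ has_index N (int_span P) s, (1 < s)%N, pf_den b = s, pf_num b ord0 = 1
      & N (oka_center P b) /\ is_Zbasis N (replace_row P ord0 (oka_center P b))].

(* All the cones occurring in the procedure started at [P0].  The clause for
   [i = ord0], which always applies because b_1 = 1, gives the smooth cone on
   C, P_2, ..., P_n; the others give the cones tau_i. *)
Inductive oka_procedure (n : nat) (N : set 'rV[K]_n.+1) (P0 : 'M[K]_n.+1) :
    'M[K]_n.+1 -> Prop :=
| oka_start : oka_procedure N P0 P0
| oka_star (P : 'M[K]_n.+1) (b : proper_fraction n.+1) (i : 'I_n.+1) :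
    oka_procedure N P0 P ->
    proper_fraction_of_cone N P b ->
    pf_num b i != 0 ->
    oka_procedure N P0 (replace_row P i (oka_center P b)).

Definition face (n : nat) (P : 'M[K]_n) (I : {set 'I_n}) : set 'rV[K]_n :=
  [set v | exists c : 'rV[K]_n,
     [/\ forall i, 0 <= c 0 i, forall i, i \notin I -> c 0 i = 0 & v = c *m P]].

(* The procedure started at sigma (generated by the rows of the identity matrix)
   stops exactly at the smooth cones, which are thus the maximal cones. *)
Definition fujiki_oka_fan (n : nat) (f : proper_fraction n.+1) :
    set (set 'rV[K]_n.+1) :=
  [set tau | exists P : 'M[K]_n.+1,
     [/\ oka_procedure (overlattice f) 1%:M P, is_Zbasis (overlattice f) P
       & exists I, tau = face P I]].

Definition is_ray (n : nat) (tau : set 'rV[K]_n) : Prop :=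
  exists u : 'rV[K]_n,
    u != 0 /\ tau = [set v | exists t : K, 0 <= t /\ v = t *: u].

Definition is_primitive_generator (n : nat) (N tau : set 'rV[K]_n)
    (A : 'rV[K]_n) : Prop :=
  tau `&` N = [set v | exists k : nat, v = A *+ k].

Definition primitive_generator (n : nat) (N tau : set 'rV[K]_n) : 'rV[K]_n :=
  xget 0 [set A | is_primitive_generator N tau A].

Definition discrepancy (n : nat) (N tau : set 'rV[K]_n) : K :=
  age (primitive_generator N tau) - 1.

Definition crepant (n : nat) (N : set 'rV[K]_n) (Sigma : set (set 'rV[K]_n)) :
    Prop :=
  forall tau, Sigma tau -> is_ray tau -> discrepancy N tau = 0.

End Toric.

Arguments overlattice K {n} f.
Arguments fujiki_oka_fan K {n} f.

(* Main.v *)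
(** The remainder polynomial is a record of the Fujiki-Oka procedure: a word w
    that is not excluded leads to a cone whose proper fraction is the coefficient
    of w, and every non-smooth cone arises in this way.  This rests on one change
    of basis.  If C is the Oka center of P and C, P_2, ..., P_n is a basis, then
    replacing P_i by C and taking the center C' with fraction R_i(b) gives
    C' = - q_i C - P_i - \sum_j q_j P_j, where q_i and q_j are the quotients of
    - s and b_j by b_i; so C' can replace P_i in the basis.  Every Oka center is a
    primitive ray generator of the fan, being a generator of the smooth cone on
    C, P_2, ..., P_n.  When all earlier generators have age 1, the age of C is the
    age of the fraction of its cone, so all generators have age 1 iff all
    coefficients do. *)
Require Import Defs.
From mathcomp Require Import all_boot all_order all_algebra.
From mathcomp Require Import classical_sets reals.
From mathcomp Require Import zify ring lra.

Set Implicit Arguments.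
Unset Strict Implicit.
Unset Printing Implicit Defensive.

Import Order.TTheory GRing.Theory Num.Theory.
Local Open Scope ring_scope.

(** * Proper fractions and the exchange of one generator *)

Lemma pf_den_gt0 (n : nat) (b : proper_fraction n) : 0 < pf_den b.
Proof. by case/andP: (pfP b) => b_ge1 _; rewrite gtz0_ge1. Qed.

Lemma pf_num_bound (n : nat) (b : proper_fraction n) (i : 'I_n) :
  0 <= pf_num b i < pf_den b.
Proof. by case/andP: (pfP b) => _ /forallP/(_ i); rewrite -ltzD1 subrK. Qed.

Lemma pf_inj (n : nat) (b c : proper_fraction n) :
  pf_den b = pf_den c -> pf_num b =1 pf_num c -> b = c.
Proof.
case: b c => [x s hb] [y t hc] /= est /ffunP exy.
case: _ / est in hc *; case: _ / exy in hc *.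
by congr ProperFraction; apply: bool_irrelevance.
Qed.

Lemma pf_den_neq0 (K : realType) (n : nat) (b : proper_fraction n) :
  (pf_den b)%:~R != 0 :> K.
Proof. by rewrite intr_eq0 gt_eqF ?pf_den_gt0. Qed.

Lemma replace_rowE (K : realType) (n : nat) (P : 'M[K]_n) (i : 'I_n) C j :
  row j (replace_row P i C) = if j == i then C else row j P.
Proof. by rewrite rowK. Qed.

Lemma mul_replace_row (K : realType) (n : nat) (P : 'M[K]_n) (i : 'I_n) C
    (v : 'rV[K]_n) :
  v *m replace_row P i C = v *m P + v 0 i *: (C - row i P).
Proof.
rewrite !mulmx_sum_row (bigD1 i) //= [in RHS](bigD1 i) //= replace_rowE eqxx.
rewrite scalerBr [RHS]addrC addrA subrK; congr (_ + _).
by apply: eq_bigr => j /negPf ji; rewrite replace_rowE ji.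
Qed.

(** * The lattice N and its bases *)

Section Overlattice.
Context (K : realType) (n : nat) (f : proper_fraction n).
Local Notation N := (overlattice K f).

Lemma overlattice_int (z : 'rV[int]_n) : N (map_mx intr z).
Proof. by exists z, 0; rewrite scale0r addr0. Qed.

Lemma overlatticeD (u v : 'rV[K]_n) : N u -> N v -> N (u + v).
Proof.
move=> [y [k ->]] [z [l ->]]; exists (y + z), (k + l).
by rewrite map_mxD intrD scalerDl addrACA.
Qed.

Lemma overlatticeZ (m : int) (v : 'rV[K]_n) : N v -> N (m%:~R *: v).
Proof.
move=> [z [k ->]]; exists (m *: z), (m * k).
by rewrite map_mxZ scalerDr scalerA intrM.
Qed.

Lemma overlattice_int_span (P : 'M[K]_n) :
  (forall i, N (row i P)) -> forall z : 'rV[int]_n, N (map_mx intr z *m P).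
Proof.
move=> NP z; rewrite mulmx_sum_row; apply: big_ind.
- by rewrite -(map_mx0 intr); apply: overlattice_int.
- exact: overlatticeD.
- by move=> i _; rewrite mxE; apply: overlatticeZ.
Qed.

(** N contains the standard basis, so the row space of P is everything. *)
Lemma span_overlattice_unitmx (P : 'M[K]_n) :
  (forall v, N v -> exists c : 'rV[K]_n, v = c *m P) -> P \in unitmx.
Proof.
move=> spanP; have: (1%:M <= P)%MS.
  apply/row_subP => i; apply/submxP; apply: spanP.
  by rewrite row1 -(map_delta_mx intr); apply: overlattice_int.
by case/submxP => Q /esym /mulmx1_unit[].
Qed.

Lemma Zbasis_unitmx (P : 'M[K]_n) : is_Zbasis N P -> P \in unitmx.
Proof.
move=> [_ spanP]; apply: span_overlattice_unitmx => v /spanP[z [-> _]].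
by exists (map_mx intr z).
Qed.

(** Uniqueness of coordinates is automatic: spanning makes P invertible, and integers embed in
    [K]. *)
Lemma spanning_Zbasis (P : 'M[K]_n) :
  (forall i, N (row i P)) ->
  (forall v, N v -> exists z : 'rV[int]_n, v = map_mx intr z *m P) ->
  is_Zbasis N P.
Proof.
move=> NP spanP; split=> // v /[dup] Nv /spanP[z vE]; exists z; split=> // y.
have unitP : P \in unitmx.
  by apply: span_overlattice_unitmx => u /spanP[x ->]; exists (map_mx intr x).
rewrite vE => /(can_inj (mulmxK unitP)) zy; apply/rowP => i.
by apply: (@intr_inj K); have /rowP/(_ i) := zy; rewrite !mxE.
Qed.
End Overlattice.

(** * Oka centers and the proper fraction of a cone *)

(** Brings vectors of an exchanged cone back to coordinates over P; once P is cancelled, lattice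
    identities are checked coordinate by coordinate. *)
Lemma mul_replace_rowM (K : realType) (n : nat) (P : 'M[K]_n) (i : 'I_n)
    (c v : 'rV[K]_n) :
  v *m replace_row P i (c *m P) = (v + v 0 i *: (c - delta_mx 0 i)) *m P.
Proof. by rewrite mul_replace_row rowE -mulmxBl scalemxAl mulmxDl. Qed.

Lemma cone_fraction_basis (K : realType) (n : nat) (N : set 'rV[K]_n.+1) P b :
  proper_fraction_of_cone N P b ->
  [/\ 1 < pf_den b, pf_num b ord0 = 1
     & is_Zbasis N (replace_row P ord0 (oka_center P b))].
Proof. by case=> s [_ s_gt1 -> b0 [_ B]]. Qed.

Lemma oka_basis_unitmx (K : realType) (n : nat) (f b : proper_fraction n) P i :
  is_Zbasis (overlattice K f) (replace_row P i (oka_center P b)) ->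
  P \in unitmx.
Proof.
case=> _ spanB; apply: (@span_overlattice_unitmx K n f) => v /spanB[z [-> _]].
by rewrite mul_replace_rowM; eexists.
Qed.

(** The index comes for free: since b_1 = 1, the span of P consists of the lattice vectors whose
    coordinate along C is divisible by s, so 0, C, ..., (s-1)C represent the cosets. *)
Lemma cone_fraction_intro (K : realType) (n : nat)
    (f b : proper_fraction n.+1) P :
  1 < pf_den b -> pf_num b ord0 = 1 ->
  is_Zbasis (overlattice K f) (replace_row P ord0 (oka_center P b)) ->
  proper_fraction_of_cone (overlattice K f) P b.
Proof.
move=> s_gt1 b0 basisB; have unitP := oka_basis_unitmx basisB.
have s_neq0 := pf_den_neq0 K b; have s_gt0 := pf_den_gt0 b.
have [NB spanB] := basisB.
set C := oka_center P b in basisB NB spanB *.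
set B := replace_row _ _ _ in basisB NB spanB.
have CB : C = row ord0 B by rewrite replace_rowE eqxx.
have NC : overlattice K f C by rewrite CB.
have spanPE (z : 'rV[int]_n.+1) :
    int_span P (map_mx intr z *m B) <-> (pf_den b %| z ord0 ord0)%Z.
  rewrite /B mul_replace_rowM; split=> [[y /(can_inj (mulmxK unitP)) /rowP yE]|].
    apply/dvdzP; exists (y ord0 ord0); apply: (@intr_inj K).
    have := yE ord0; rewrite !mxE !eqxx b0 rmorphM /= => <-.
    by field.
  case/dvdzP=> q zE.
  (* With z_1 = q s, the term z_1 C equals q (P_1 + \sum_j b_j P_j); the last summand leaves just q
     at P_1. *)
  exists (\row_j (z ord0 j + q * pf_num b j - z ord0 ord0 * (j == ord0)%:R)).
  congr (_ *m _); apply/rowP => j; rewrite !mxE zE.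
  by rewrite !rmorphB /= !rmorphD !rmorphM /= rmorph_nat; field.
have diffE (z : 'rV[int]_n.+1) (k : int) :
    int_span P (map_mx intr z *m B - k%:~R *: C) <->
    (pf_den b %| z ord0 ord0 - k)%Z.
  have -> : map_mx intr z *m B - k%:~R *: C =
      map_mx intr (z - k *: delta_mx 0 ord0) *m B.
    by rewrite CB rowE -(map_delta_mx intr) scalemxAl -map_mxZ -mulmxBl map_mxB.
  by rewrite spanPE !mxE mulr1.
exists `|pf_den b|%N; split=> //; [|lia|lia].
exists (fun k => (k : nat)%:~R *: C); split=> [k|v /spanB[z [-> _]]].
  exact: overlatticeZ.
have k_lt : (`|(z ord0 ord0 %% pf_den b)%Z| < `|pf_den b|)%N by lia.
have mod_ge0 : 0 <= (z ord0 ord0 %% pf_den b)%Z by rewrite modz_ge0 ?gt_eqF.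
exists (Ordinal k_lt); split=> [|k].
  by apply/diffE; rewrite /= gez0_abs // -eqz_mod_dvd modz_mod.
move=> /diffE; rewrite -eqz_mod_dvd => /eqP k_mod; apply: val_inj => /=.
by rewrite k_mod modz_small ?absz_nat //; have := ltn_ord k; lia.
Qed.

(** Each center is an integral combination of the basis built from the other. The P_1-coordinates
    show that the two denominators divide each other; once they agree, the numerators are congruent
    modulo the denominator and lie in the same range. *)
Lemma cone_fraction_uniq (K : realType) (n : nat)
    (f b c : proper_fraction n.+1) P :
  proper_fraction_of_cone (overlattice K f) P b ->
  proper_fraction_of_cone (overlattice K f) P c -> b = c.
Proof.
(* The expansion of the center of e in the basis given by d, with denominators cleared. *)
have num_den d e : proper_fraction_of_cone (overlattice K f) P d ->
    proper_fraction_of_cone (overlattice K f) P e ->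
    exists z : 'rV[int]_n.+1, forall j, pf_num e j * pf_den d =
      pf_den e * (z 0 j * pf_den d +
                  z 0 ord0 * (pf_num d j - pf_den d * (j == ord0)%:R)).
  move=> pd pe; have unitP : P \in unitmx.
    by have [_ _ /oka_basis_unitmx] := cone_fraction_basis pd.
  have [_ _ [_ span_d]] := cone_fraction_basis pd.
  case: pe => t [_ _ _ _ [/span_d[z [zE _]] _]]; exists z => j.
  have d_neq0 := pf_den_neq0 K d; have e_neq0 := pf_den_neq0 K e.
  move: zE; rewrite mul_replace_rowM => /(can_inj (mulmxK unitP))/rowP/(_ j).
  rewrite !mxE /= => zE; apply: (@intr_inj K).
  rewrite !rmorphM rmorphD !rmorphM rmorphB rmorphM rmorph_nat /=.
  have -> : (pf_num e j)%:~R =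
      (pf_num e j)%:~R / (pf_den e)%:~R * (pf_den e)%:~R :> K.
    by rewrite divfK.
  by rewrite zE; field.
move=> pb pc.
have [s_gt1 b0 _] := cone_fraction_basis pb.
have [t_gt1 c0 _] := cone_fraction_basis pc.
have [z zE] := num_den _ _ pb pc; have [y yE] := num_den _ _ pc pb.
have := zE ord0; have := yE ord0; rewrite b0 c0 eqxx !mulr1 => y0 z0.
have ts : pf_den b = pf_den c * z 0 ord0 by rewrite -[LHS]mul1r z0; ring.
have st : pf_den c = pf_den b * y 0 ord0 by rewrite -[LHS]mul1r y0; ring.
have st_eq : pf_den b = pf_den c.
  have z_gt0 : 0 < z 0 ord0 by nia.
  have y_gt0 : 0 < y 0 ord0 by nia.
  by nia.
apply: pf_inj => // j; have [->|j0] := eqVneq j ord0; first by rewrite b0 c0.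
have z1 : z 0 ord0 = 1 by nia.
have := zE j; rewrite (negPf j0) z1 st_eq.
have := pf_num_bound b j; have := pf_num_bound c j; rewrite st_eq => cj bj.
have t_neq0 : pf_den c != 0 by lia.
rewrite mulr0 subr0 mul1r mulrC => /(mulfI t_neq0) cjE.
by rewrite -(modz_small cj) cjE modzMDl modz_small.
Qed.

(** The center would have P_1-coordinate 1/s, which is not an integer as s > 1. *)
Lemma Zbasis_no_cone_fraction (K : realType) (n : nat)
    (f b : proper_fraction n.+1) P :
  is_Zbasis (overlattice K f) P ->
  ~ proper_fraction_of_cone (overlattice K f) P b.
Proof.
move=> basisP pb; have [s_gt1 b0 _] := cone_fraction_basis pb.
case: pb => [s [_ _ _ _ [/(proj2 basisP)[z [zE _]] _]]].
have := can_inj (mulmxK (Zbasis_unitmx basisP)) zE.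
move=> /rowP/(_ ord0); rewrite !mxE b0 => {}zE.
suff : (pf_den b %| 1)%Z by rewrite dvdz1; lia.
apply/dvdzP; exists (z ord0 ord0); apply: (@intr_inj K).
by rewrite intrM -zE divfK ?pf_den_neq0.
Qed.

Lemma residuesE (n : nat) (x : 'I_n -> int) (m : int) (m_gt0 : 0 < m) i :
  pf_num (residues x m_gt0) i = (x i %% m)%Z.
Proof. by rewrite ffunE. Qed.

Lemma cone_fraction_star (K : realType) (n : nat) (f b : proper_fraction n.+1) P
    (i : 'I_n.+1) (x := fun j => if j == i then - pf_den b else pf_num b j)
    (bi_gt0 : 0 < pf_num b i) :
  i != ord0 -> 1 < pf_num b i ->
  proper_fraction_of_cone (overlattice K f) P b ->
  proper_fraction_of_cone (overlattice K f) (replace_row P i (oka_center P b))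
    (residues x bi_gt0).
Proof.
move=> i0 bi_gt1 pb; have [s_gt1 b0 basisB] := cone_fraction_basis pb.
have i0' : ord0 != i by rewrite eq_sym.
have b'0 : pf_num (residues x bi_gt0) ord0 = 1.
  by rewrite residuesE /x (negPf i0') b0 modz_small //; lia.
apply: cone_fraction_intro => //.
(* Because b_i > 1, the quotient of b_1 = 1 vanishes, so P_1 is absent from the expansion of C'. *)
have div1m : (1 %/ pf_num b i)%Z = 0 by rewrite divz_small //; lia.
have [NB spanB] := basisB.
have s_neq0 := pf_den_neq0 K b.
have m_neq0 : (pf_num b i)%:~R != 0 :> K by rewrite intr_eq0 gt_eqF.
set C := oka_center P b in basisB NB spanB *.
set B := replace_row P ord0 C in basisB NB spanB.
set P' := replace_row P i C.
set C' := oka_center P' _.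
pose q j : K := (x j %/ pf_num b i)%Z%:~R.
(* Coordinates of C' over C, P_2, ..., P_n; position [ord0] belongs to C and receives - q_i. *)
pose u : 'rV[int]_n.+1 := \row_j (if j == i then -1
  else if j == ord0 then - (x i %/ pf_num b i)%Z
  else - (x j %/ pf_num b i)%Z).
have numE j : (pf_num (residues x bi_gt0) j)%:~R =
    (x j)%:~R - q j * (pf_num b i)%:~R :> K.
  rewrite residuesE /q -intrM -intrB {2}(divz_eq (x j) (pf_num b i)).
  by rewrite addrAC subrr add0r.
have C'E : C' = map_mx intr u *m B.
  rewrite /C' /oka_center /P' /B mul_replace_rowM mul_replace_rowM; congr (_ *m _).
  apply/rowP => j; rewrite !mxE !numE /x !eqxx /= (negPf i0').
  have [->|ji] := eqVneq j i.
    by rewrite (negPf i0) /q /x eqxx !rmorphN rmorph1 /=; field;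
       rewrite ?s_neq0 ?m_neq0.
  have [->|j0] := eqVneq j ord0.
    rewrite /q /x eqxx (negPf i0') b0 div1m.
    by rewrite !rmorphN ?rmorph1 ?rmorph0 /=; field; rewrite ?s_neq0 ?m_neq0.
  by rewrite /q /x eqxx (negPf ji) !rmorphN /=; field; rewrite ?s_neq0 ?m_neq0.
apply: spanning_Zbasis.
  move=> j; rewrite replace_rowE; have [_|j0] := eqVneq j ord0.
    by rewrite C'E; apply: overlattice_int_span.
  rewrite replace_rowE; have [_|ji] := eqVneq j i.
    by have := NB ord0; rewrite replace_rowE eqxx.
  by have := NB j; rewrite replace_rowE (negPf j0).
move=> v /spanB[z [-> _]].
(* Obtained by substituting P_i = - C' - q_i C - \sum_j q_j P_j; now C' sits at [ord0] and C at
   [i]. *)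
exists (\row_j (if j == ord0 then - z 0 i
  else if j == i then z 0 ord0 - (x i %/ pf_num b i)%Z * z 0 i
  else z 0 j - (x j %/ pf_num b i)%Z * z 0 i)).
rewrite /C' /oka_center mul_replace_rowM /P' /C /B mul_replace_rowM mul_replace_rowM.
congr (_ *m _); apply/rowP => j; rewrite !mxE !numE /x !eqxx /= (negPf i0).
have [->|ji] := eqVneq j i.
  rewrite (negPf i0) /q /x !eqxx !rmorphN !rmorphB !rmorphM /=.
  by field; rewrite ?s_neq0 ?m_neq0.
have [->|j0] := eqVneq j ord0.
  rewrite /q /x eqxx ?(negPf i0') ?b0 div1m.
  by rewrite !rmorphN !rmorphB !rmorphM ?rmorph0 /=; field;
     rewrite ?s_neq0 ?m_neq0.
rewrite /q /x eqxx (negPf ji) !rmorphN !rmorphB !rmorphM /=.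
by field; rewrite ?s_neq0 ?m_neq0.
Qed.


(** The case b_i = 1, where R_i(b) is the excluded (0,...,0)/1. A center with denominator t > 1
    would be integral over C, P_2, ..., P_n; subtracting its P_i-coordinate from its P_1-coordinate
    would make 1/t an integer. *)
Lemma cone_fraction_star_smooth (K : realType) (n : nat)
    (f b c : proper_fraction n.+1) P i :
  i != ord0 -> pf_num b i = 1 ->
  proper_fraction_of_cone (overlattice K f) P b ->
  ~ proper_fraction_of_cone (overlattice K f) (replace_row P i (oka_center P b)) c.
Proof.
move=> i0 bi pb pc; have [_ b0 basisB] := cone_fraction_basis pb.
have [t_gt1 c0 _] := cone_fraction_basis pc.
have unitP := oka_basis_unitmx basisB.
case: pc => t [_ _ _ _ [/(proj2 basisB)[z [zE _]] _]].
have s_neq0 := pf_den_neq0 K b; have t_neq0 := pf_den_neq0 K c.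
move: zE; rewrite /(oka_center (replace_row _ _ _)) !mul_replace_rowM.
move=> /(can_inj (mulmxK unitP))/rowP zE.
have := zE i; have := zE ord0; rewrite !mxE b0 c0 bi !eqxx /=.
rewrite (eq_sym ord0) (negPf i0) /= => z0 zi.
suff : (pf_den c %| 1)%Z by rewrite dvdz1; lia.
apply/dvdzP; exists (- z ord0 i); apply: (@intr_inj K).
rewrite rmorphM rmorphN /=.
have : 1 / (pf_den c)%:~R = - (z ord0 i)%:~R :> K by lra.
by move=> <-; field.
Qed.

Lemma cone_fraction_overlattice (K : realType) (n : nat)
    (f : proper_fraction n.+1) :
  1 < pf_den f -> pf_num f ord0 = 1 ->
  proper_fraction_of_cone (overlattice K f) 1%:M f.
Proof.
move=> r_gt1 f0; apply: cone_fraction_intro => //; rewrite /oka_center.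
have r_neq0 := pf_den_neq0 K f.
apply: spanning_Zbasis => [j|v [z [k ->]]].
  rewrite replace_rowE; case: eqP => _; last first.
    by rewrite row1 -(map_delta_mx intr); apply: overlattice_int.
  by exists 0, 1; rewrite map_mx0 add0r scale1r mulmx1.
(* The center of the initial cone is the vector of [f] itself; substitute e_1 = r C - \sum_j a_j
   e_j. *)
exists (\row_j (if j == ord0 then pf_den f * z 0 ord0 + k
                else z 0 j - z 0 ord0 * pf_num f j)).
rewrite mul_replace_rowM mulmx1; apply/rowP => j; rewrite !mxE /=.
have [->|j0] := eqVneq j ord0; first by rewrite f0 rmorphD rmorphM /=; field.
by rewrite rmorphB rmorphD !rmorphM /=; field.
Qed.

(** * Coefficients of the remainder polynomial, letter by letter *)

Lemma remainder_mapE (n : nat) (b : proper_fraction n) i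
    (bi_gt0 : 0 < pf_num b i) :
  remainder_map i (Some b) =
  Some (residues (fun j => if j == i then - pf_den b else pf_num b j) bi_gt0).
Proof.
rewrite /=; case: decP => [bi|]; last by rewrite gt_eqF.
by congr (Some (residues _ _)); apply: bool_irrelevance.
Qed.

Lemma remainder_map0 (n : nat) (b : proper_fraction n) i :
  pf_num b i = 0 -> remainder_map i (Some b) = None.
Proof.
by move=> bi; rewrite /=; case: decP => // bi'; case/negP: (bi'); apply/eqP.
Qed.

(** Over the denominator 1 all numerators are forced to be 0, so exclusion is a test on the index
    alone. *)
Lemma is_zero_over_one_den (n : nat) (b : proper_fraction n) :
  is_zero_over_one b = (pf_den b == 1).
Proof.
rewrite /is_zero_over_one; case: eqP => //= b1; apply/forallP => i.
by have := pf_num_bound b i; rewrite b1; lia.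
Qed.

Lemma remainder_polynomial_rcons (n : nat) (f b : proper_fraction n.+1) w i
    (bi_gt0 : 0 < pf_num b (lift ord0 i)) :
  remainder_polynomial f w = Some b -> 1 < pf_num b (lift ord0 i) ->
  remainder_polynomial f (rcons w i) =
  Some (residues (fun j => if j == lift ord0 i then - pf_den b else pf_num b j)
                 bi_gt0).
Proof.
rewrite /remainder_polynomial foldl_rcons; case: foldl => // c; case: ifP => // _.
by case=> -> bi_gt1; rewrite remainder_mapE is_zero_over_one_den /= gt_eqF.
Qed.

(** Occurring words are closed under prefixes, because every remainder map sends both oo and
    (0,...,0)/1 to oo. *)
Lemma remainder_polynomial_rcons_inv (n : nat)
    (f c : proper_fraction n.+1) w i :
  remainder_polynomial f (rcons w i) = Some c ->
  exists b (bi_gt0 : 0 < pf_num b (lift ord0 i)),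
    [/\ remainder_polynomial f w = Some b, 1 < pf_num b (lift ord0 i)
      & c = residues (fun j => if j == lift ord0 i then - pf_den b else pf_num b j)
                     bi_gt0].
Proof.
rewrite /remainder_polynomial foldl_rcons; case: foldl => // b.
have [bi|bi] := eqVneq (pf_num b (lift ord0 i)) 0; first by rewrite remainder_map0.
have bi_gt0 := pf_num_gt0 bi; rewrite remainder_mapE is_zero_over_one_den /=.
case: eqP => // bi1 [<-]; exists b, bi_gt0; split; last by [].
  rewrite /is_zero_over_one; case: andP => // -[_ /forallP/(_ (lift ord0 i))].
  by rewrite (negPf bi).
by lia.
Qed.

(** * Words against non-smooth cones *)

Lemma coefficient_cone_fraction (K : realType) (n : nat)
    (f c : proper_fraction n.+1) w :
  1 < pf_den f -> pf_num f ord0 = 1 -> remainder_polynomial f w = Some c ->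
  exists P, oka_procedure (overlattice K f) 1%:M P /\
    proper_fraction_of_cone (overlattice K f) P c.
Proof.
move=> r_gt1 f0; elim/last_ind: w c => [|w i IHw] c.
  rewrite /remainder_polynomial /=; case: ifP => // _ [<-].
  by exists 1%:M; split; [exact: oka_start | exact: cone_fraction_overlattice].
case/remainder_polynomial_rcons_inv => b [bi_gt0 [/IHw[P [PP pb]] bi_gt1 ->]].
exists (replace_row P (lift ord0 i) (oka_center P b)); split.
  by apply: oka_star => //; rewrite gt_eqF.
by apply: cone_fraction_star => //; rewrite eq_sym neq_lift.
Qed.

(** Induction on the procedure. Exchanging P_1, or some P_i with b_i = 1, yields a cone without a
    fraction; otherwise uniqueness identifies the fraction with R_i(b), and the word grows by one
    letter. *)
Lemma cone_fraction_coefficient (K : realType) (n : nat)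
    (f c : proper_fraction n.+1) P :
  1 < pf_den f -> pf_num f ord0 = 1 ->
  oka_procedure (overlattice K f) 1%:M P ->
  proper_fraction_of_cone (overlattice K f) P c ->
  is_coefficient (remainder_polynomial f) c.
Proof.
move=> r_gt1 f0 PP; elim: PP c => [|{}P b i _ IHP pb bi] c pc.
  exists [::]; rewrite (cone_fraction_uniq pc (cone_fraction_overlattice K r_gt1 f0)).
  by rewrite /remainder_polynomial /= is_zero_over_one_den gt_eqF.
have bi_gt0 := pf_num_gt0 bi.
case: (unliftP ord0 i) => [j|] iE; subst i; last first.
  by have [_ _ /Zbasis_no_cone_fraction] := cone_fraction_basis pb => /(_ _ pc).
have j0 : lift ord0 j != ord0 by rewrite eq_sym neq_lift.
have [w wb] := IHP _ pb; exists (rcons w j).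
have [bi1|bi1] := eqVneq (pf_num b (lift ord0 j)) 1.
  by case: (cone_fraction_star_smooth j0 bi1 pb pc).
have bi_gt1 : 1 < pf_num b (lift ord0 j) by lia.
rewrite (cone_fraction_uniq pc (cone_fraction_star bi_gt0 j0 bi_gt1 pb)).
exact: remainder_polynomial_rcons.
Qed.

(** * Ages of generators and centers *)

Lemma age_mulmx (K : realType) (n : nat) (P : 'M[K]_n) (v : 'rV[K]_n) :
  (forall i, age (row i P) = 1) -> age (v *m P) = age v.
Proof.
move=> ageP; rewrite /age; under eq_bigr => j _ do rewrite mxE.
rewrite exchange_big; apply: eq_bigr => i _; rewrite -mulr_sumr.
have := ageP i; rewrite /age; under eq_bigr => j _ do rewrite mxE.
by move=> ->; rewrite mulr1.
Qed.

Lemma age_pf_vector (K : realType) (n : nat) (b : proper_fraction n) :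
  age (pf_vector K b) = ratr (pf_age b).
Proof.
rewrite /age /pf_age fmorph_div /= !ratr_int rmorph_sum mulr_suml.
by apply: eq_bigr => i _; rewrite mxE.
Qed.

Lemma age_oka_center_eq1 (K : realType) (n : nat)
    (b : proper_fraction n) (P : 'M[K]_n) :
  (forall i, age (row i P) = 1) -> age (oka_center P b) = 1 <-> pf_age b = 1.
Proof.
move=> ageP; rewrite age_mulmx // age_pf_vector -(rmorph1 (@ratr K)).
by split=> [/fmorph_inj|->].
Qed.

(** The premise only concerns cones whose generators already have age 1, which the induction
    provides. *)
Lemma age_procedure (K : realType) (n : nat) (N : set 'rV[K]_n.+1) P :
  (forall Q b, oka_procedure N 1%:M Q -> (forall i, age (row i Q) = 1) ->
    proper_fraction_of_cone N Q b -> age (oka_center Q b) = 1) ->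
  oka_procedure N 1%:M P -> forall i, age (row i P) = 1.
Proof.
move=> ageC; elim=> [|{}P b j PP ageP pb _] i; last first.
  by rewrite replace_rowE; case: ifP => // _; apply: ageC.
rewrite row1 /age (bigD1 i) //= mxE !eqxx big1 ?addr0 // => j /negPf ji.
by rewrite mxE ji andbF.
Qed.

(** * Rays of the fan and their primitive generators *)

Definition half_line (K : realType) (n : nat) (u : 'rV[K]_n) : set 'rV[K]_n :=
  [set v | exists t : K, 0 <= t /\ v = t *: u]%classic.

Lemma row_neq0 (K : realType) (n : nat) (P : 'M[K]_n) i :
  P \in unitmx -> row i P != 0.
Proof.
move=> unitP; rewrite rowE -(mul0mx _ P) (can_eq (mulmxK unitP)).
by apply/eqP => /rowP/(_ i)/eqP; rewrite !mxE !eqxx oner_eq0.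
Qed.

Lemma is_primitive_generator_row (K : realType) (n : nat)
    (f : proper_fraction n) P i :
  is_Zbasis (overlattice K f) P ->
  is_primitive_generator (overlattice K f) (half_line (row i P)) (row i P).
Proof.
move=> basisP; apply/seteqP; split=> v /=.
  case=> -[t [t_ge0 ->]] /(proj2 basisP)[z [zE _]].
  move: zE; rewrite rowE scalemxAl => /(can_inj (mulmxK (Zbasis_unitmx basisP))) zE.
  have /rowP/(_ i) := zE; rewrite !mxE !eqxx mulr1 => ti.
  move: t_ge0; rewrite ti ler0z => zi_ge0; exists `|z ord0 i|%N.
  by rewrite -scaler_nat natr_absz ger0_norm // scalemxAl.
case=> k ->; split; first by exists k%:R; rewrite scaler_nat.
by have := overlatticeZ k (proj1 basisP i); rewrite -scaler_nat.
Qed.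

(** Two primitive generators are natural multiples of each other, by factors with product 1 since
    the row is nonzero. *)
Lemma primitive_generator_row (K : realType) (n : nat)
    (f : proper_fraction n) P i :
  is_Zbasis (overlattice K f) P ->
  primitive_generator (overlattice K f) (half_line (row i P)) = row i P.
Proof.
move=> basisP; have prim := is_primitive_generator_row i basisP.
rewrite /primitive_generator; set A := xget _ _.
have primA : is_primitive_generator (overlattice K f) (half_line (row i P)) A.
  (* The default 0 of [xget] is not reached, as the row is a candidate. *)
  by apply: (@xgetPex _ 0 (is_primitive_generator _ _)); exists (row i P).
have multE : [set v | exists k, v = A *+ k]%classic =
    [set v | exists k, v = row i P *+ k]%classic by rewrite -primA -prim.
have [k kE] : exists k, A = row i P *+ k.
  by have /seteqP[+ _] := multE; apply; exists 1%N.
have [l lE] : exists l, row i P = A *+ l.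
  by have /seteqP[_ +] := multE; apply; exists 1%N.
have : row i P *+ (k * l) == row i P *+ 1 by rewrite mulrnA -kE -lE.
rewrite -!scaler_nat -subr_eq0 -scalerBl scaler_eq0.
rewrite (negPf (row_neq0 _ (Zbasis_unitmx basisP))) orbF subr_eq0 eqr_nat muln_eq1.
by move=> /andP[/eqP k1 _]; rewrite kE k1.
Qed.

Lemma face_set1 (K : realType) (n : nat) (P : 'M[K]_n) i :
  face P [set i] = half_line (row i P).
Proof.
apply/seteqP; split=> v /=.
  case=> c [c_ge0 c0 ->]; exists (c 0 i); split=> //.
  rewrite mulmx_sum_row (bigD1 i) //= big1 ?addr0 // => j ji.
  by rewrite c0 ?scale0r // inE.
case=> t [t_ge0 ->]; exists (t *: delta_mx 0 i); split=> [j|j|].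
- by rewrite !mxE mulr_ge0 // ler0n.
- by rewrite inE !mxE eqxx => /negPf ->; rewrite mulr0.
- by rewrite -scalemxAl -rowE.
Qed.

Lemma half_line_scale (K : realType) (n : nat) (t : K) (u : 'rV[K]_n) :
  0 < t -> half_line (t *: u) = half_line u.
Proof.
move=> t_gt0; apply/seteqP; split=> v [s [s_ge0 ->]].
  by exists (s * t); rewrite scalerA mulr_ge0 // ltW.
by exists (s / t); rewrite scalerA divfK ?gt_eqF // divr_ge0 // ltW.
Qed.

(** A direction vector of the ray has some nonzero coordinate c_i, hence i lies in I; then row i is
    a nonzero point of the ray and spans it. *)
Lemma is_ray_face (K : realType) (n : nat) (P : 'M[K]_n) (I : {set 'I_n}) :
  P \in unitmx -> is_ray (face P I) -> exists i, face P I = half_line (row i P).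
Proof.
move=> unitP [u [u_neq0]]; rewrite -/(half_line u) => faceE.
have : face P I u by rewrite faceE; exists 1; rewrite scale1r.
case=> c [c_ge0 c0 uE].
have /existsP[i ci] : [exists i, c 0 i != 0].
  apply: contraNT u_neq0 => /existsPn c_eq0; rewrite uE (_ : c = 0) ?mul0mx //.
  by apply/rowP => i; apply/eqP; rewrite mxE; apply: negbNE; apply: c_eq0.
have iI : i \in I by apply: contraNT ci => /c0 ->.
exists i; have : face P I (row i P).
  exists (delta_mx 0 i); split=> [j|j jI|]; last by rewrite -rowE.
    by rewrite mxE ler0n.
  by rewrite mxE eqxx; case: eqP jI => // ->; rewrite iI.
rewrite faceE => -[t [t_ge0 rowE]]; rewrite rowE half_line_scale // lt_def t_ge0.
rewrite andbT; apply: contra_eqN rowE => /eqP->.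
by rewrite scale0r row_neq0.
Qed.

Theorem theorem3p1 (K : realType) (n : nat) (r : int) (a : 'I_n -> int)
    (r_ge2 : 2 <= r) (a_bound : forall i : 'I_n, 0 <= a i <= r - 1) :
  crepant (overlattice K (pf1 r_ge2 a_bound))
          (fujiki_oka_fan K (pf1 r_ge2 a_bound)) <->
  (forall c : proper_fraction n.+1,
     is_coefficient (remainder_polynomial (pf1 r_ge2 a_bound)) c ->
     pf_age c = 1).
Proof.
set f := pf1 r_ge2 a_bound.
have r_gt1 : 1 < pf_den f by rewrite /=; lia.
have f0 : pf_num f ord0 = 1 by rewrite ffunE unlift_none.
split=> [crep c [w wc]|agec tau [P [PP basisP [I ->]]] rayI].
  have ageC Q b : oka_procedure (overlattice K f) 1%:M Q ->
      proper_fraction_of_cone (overlattice K f) Q b -> age (oka_center Q b) = 1.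
    move=> QQ qb; have [_ b0 basisB] := cone_fraction_basis qb.
    set B := replace_row _ _ _ in basisB.
    have CB : oka_center Q b = row ord0 B by rewrite replace_rowE eqxx.
    have := crep (face B [set ord0]); rewrite face_set1 CB.
    rewrite /discrepancy primitive_generator_row // => /(_ _ _)/eqP.
    rewrite subr_eq0 => crepB; apply/eqP; apply: crepB.
      exists B; split=> //; last by exists [set ord0]; rewrite face_set1.
      (* Since b_1 = 1 is nonzero, the procedure does produce the cone on C, P_2, ..., P_n. *)
      by apply: oka_star => //; rewrite b0.
    by exists (row ord0 B); rewrite row_neq0 // (Zbasis_unitmx basisB).
  have [P [PP pc]] := coefficient_cone_fraction K r_gt1 f0 wc.
  apply/(@age_oka_center_eq1 K _ _ P); last exact: ageC.
  by apply: age_procedure PP => Q b QQ _; apply: ageC.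
have [i ->] := is_ray_face (Zbasis_unitmx basisP) rayI.
rewrite /discrepancy primitive_generator_row //; apply/eqP.
rewrite subr_eq0; apply/eqP.
(* The generators of [Q] have age 1 here, so the age of its center is that of the coefficient
   [b]. *)
apply: (age_procedure _ PP) => Q b QQ ageQ qb; apply/(age_oka_center_eq1 _ ageQ).
by apply: agec; apply: cone_fraction_coefficient QQ qb.
Qed.
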